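(* An admissible kneading invariant $K=(k_+,k_-)$ can be factorized uniquely as a $*$-product of prime kneading invariants. More precisely: (1) If $K$ is finitely renormalizable, there is a positive integer $m$ such that $R^mK=:K^*=(k^*_+,k^*_-)$ is prime, and there are $m$ pairs of finite words $W_i=(w_{i,+},w_{i,-})$ such that each $W_i^\infty=(w_{i,+}^\infty,w_{i,-}^\infty)$ $(i=1,\dots,m)$ is an admissible periodic prime kneading invariant and $$K=W_1*\cdots*W_m*K^*.$$ (2) If $K$ is infinitely renormalizable, there is a sequence of pairs of finite words $W_i=(w_{i,+},w_{i,-})$ such that each $W_i^\infty=(w_{i,+}^\infty,w_{i,-}^\infty)$ $(i=1,2,\dots)$ is an admissible periodic prime kneading invariant and $$K=W_1*W_2*W_3*\cdots.$$
   Context: Let $\sigma$ be the shift on $\{0,1\}^\infty$, ordered lexicographically. A pair $K=(k_+,k_-)$ of sequences with $k_+=1\cdots$, $k_-=0\cdots$ is an admissible (expansive) kneading invariant if it is the kneading invariant of an expansive Lorenz map, equivalently if for all $n\ge 0$ $$\sigma(k_+)\le\sigma^n(k_+)<\sigma(k_-),\qquad \sigma(k_+)<\sigma^n(k_-)\le\sigma(k_-).$$ An admissible periodic kneading invariant is a pair $(w_+^\infty,w_-^\infty)$, with $w_+=1\cdots$ and $w_-=0\cdots$ finite words of length $>1$ (each the shortest period word of the sequence it generates), that either satisfies the displayed condition or is the kneading invariant of a rational rotation $x\mapsto x+p/q\pmod 1$, $0<p/q<1$, i.e. the pair of one-sided itineraries at $c+$ and $c-$ with $c=1-p/q$, where points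 below (above) $c$ are coded $0$ ($1$); in the latter case both sequences lie in one periodic $\sigma$-orbit. For $W=(w_+,w_-)$ and a kneading invariant $K^1=(k^1_+,k^1_-)$, the $*$-product $W*K^1$ is the pair obtained from $K^1$ by replacing every symbol $1$ by the word $w_+$ and every symbol $0$ by the word $w_-$; the operation is associative. $K$ is renormalizable (by $W$) if $K=W*K^1$, with $W^\infty$ an admissible periodic kneading invariant and $K^1$ a kneading invariant (admissible if $K$ is); so $k_+=w_+w_-^{p_1}w_+^{p_2}\cdots$, $k_-=w_-w_+^{m_1}w_-^{m_2}\cdots$ with $p_1,m_1>0$. Otherwise $K$ is prime. If $K$ is renormalizable, $RK$ denotes $K^1$ for the minimal renormalization (the one with shortest words), and $R^n=R\circ R^{n-1}$. $K$ is finitely renormalizable if it is renormalizable but the process $K,RK,R^2K,\dots$ stops after finitely many steps, and infinitely renormalizable if it never stops. In the infinite case, $K=W_1*W_2*\cdots$ means $K=W_1*\cdots*W_n*R^nK$ for every $n\ge1$. For prime $K$ the factorization is $K$ itself. *)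

(* Defs.v *)
From Stdlib Require Import Reals.
From mathcomp Require Import all_boot.

Set Implicit Arguments.
Unset Strict Implicit.
Unset Printing Implicit Defensive.

(* The symbols 1 and 0 are [true] and [false].  In every pair below, the first
   component is the "+" entry and the second one the "-" entry. *)
Definition binseq := nat -> bool.
Definition kneading := (binseq * binseq)%type.
Definition words := (seq bool * seq bool)%type.

Definition shift (n : nat) (s : binseq) : binseq := fun i => s (n + i).

Definition lexlt (s t : binseq) : Prop :=
  exists n, [/\ forall i, i < n -> s i = t i, s n = false & t n = true].

Definition lexle (s t : binseq) : Prop := lexlt s t \/ s = t.

Definition admissible (K : kneading) : Prop :=
  [/\ K.1 0 = true, K.2 0 = false &
   forall n,
     [/\ lexle (shift 1 K.1) (shift n K.1), lexlt (shift n K.1) (shift 1 K.2),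
         lexlt (shift 1 K.1) (shift n K.2) & lexle (shift n K.2) (shift 1 K.2)]].

Section Rotation.
Local Open Scope R_scope.

Definition rotation (a x : R) : R := frac_part (x + a).

Definition coded (c x : R) (b : bool) : Prop := if b then c < x else x < c.

Definition itinerary_right (f : R -> R) (c : R) (s : binseq) : Prop :=
  forall n, exists2 d, 0 < d &
    forall x, c < x < c + d -> coded c (iter n f x) (s n).

Definition itinerary_left (f : R -> R) (c : R) (s : binseq) : Prop :=
  forall n, exists2 d, 0 < d &
    forall x, c - d < x < c -> coded c (iter n f x) (s n).

Definition rational_rotation (K : kneading) : Prop :=
  exists p q : nat,
    let a := INR p / INR q in
    [/\ (0 < p < q)%N, itinerary_right (rotation a) (1 - a) K.1
      & itinerary_left (rotation a) (1 - a) K.2].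

End Rotation.

Definition kneading_invariant (K : kneading) : Prop :=
  admissible K \/ rational_rotation K.

(* The value is only meaningful for a nonempty word. *)
Definition wordpow (w : seq bool) : binseq := fun i => nth false w (i %% size w).

Definition wordspow (W : words) : kneading := (wordpow W.1, wordpow W.2).

Definition primitive_word (w : seq bool) : Prop :=
  forall u : seq bool, 0 < size u -> wordpow u = wordpow w -> size w <= size u.

Definition periodic_admissible (W : words) : Prop :=
  [/\ 1 < size W.1 /\ 1 < size W.2, head false W.1 = true /\ head true W.2 = false,
      primitive_word W.1 /\ primitive_word W.2 & kneading_invariant (wordspow W)].

(* When both words are nonempty, the images of the first [n.+1] symbols have
   total length at least [n.+1], so they determine the symbol of index [n]. *)
Definition substw (W : words) (s : binseq) : binseq := fun n =>
  nth false
    (flatten [seq (if s i then W.1 else W.2) | i <- iota 0 n.+1]) n.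

Definition star (W : words) (K : kneading) : kneading :=
  (substw W K.1, substw W K.2).

Definition renormalizes (W : words) (K K1 : kneading) : Prop :=
  [/\ periodic_admissible W, kneading_invariant K1,
      admissible K -> admissible K1 & K = star W K1].

Definition renormalizable (K : kneading) : Prop :=
  exists W K1, renormalizes W K K1.

Definition prime_kneading (K : kneading) : Prop :=
  kneading_invariant K /\ ~ renormalizable K.

Definition minimally_renormalizes (W : words) (K K1 : kneading) : Prop :=
  renormalizes W K K1 /\
  forall V K2, renormalizes V K K2 ->
    size W.1 <= size V.1 /\ size W.2 <= size V.2.

(* [Riter n K L] means that [R^n K] is defined and equal to [L].  The operator
   [R] is partial, hence a relation; its value is unique, since the words of a
   renormalization of [K] are prefixes of the sequences of [K]. *)
Fixpoint Riter (n : nat) (K L : kneading) : Prop :=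
  if n is m.+1 then
    exists K1, Riter m K K1 /\ exists W, minimally_renormalizes W K1 L
  else K = L.

Definition finitely_renormalizable (K : kneading) : Prop :=
  renormalizable K /\ exists m L, Riter m K L /\ ~ renormalizable L.

Definition infinitely_renormalizable (K : kneading) : Prop :=
  forall n L, Riter n K L -> renormalizable L.

Definition prime_words (W : words) : Prop :=
  periodic_admissible W /\ prime_kneading (wordspow W).

Definition starprod (Ws : seq words) (K : kneading) : kneading :=
  foldr star K Ws.

Definition infinite_starprod (K : kneading) (W : nat -> words) : Prop :=
  forall n, 0 < n -> exists2 L, Riter n K L & K = starprod (mkseq W n) L.

(* A finite factorization consists of the list of its word pairs, which is
   empty for a prime kneading invariant, and of its last factor. *)
Inductive factorization :=
  | FiniteFact of seq words & kneading
  | InfiniteFact of nat -> words.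

Definition prime_factorization (K : kneading) (F : factorization) : Prop :=
  match F with
  | FiniteFact Ws L =>
      [/\ forall W, W \in Ws -> prime_words W, prime_kneading L
        & K = starprod Ws L]
  | InfiniteFact W => (forall i, prime_words (W i)) /\ infinite_starprod K W
  end.

(* Main.v *)
From Stdlib Require Import Reals Lra Classical ClassicalEpsilon FunctionalExtensionality.
Require Import Defs.
From mathcomp Require Import all_boot.

Set Implicit Arguments.
Unset Strict Implicit.
Unset Printing Implicit Defensive.

(** Why factorizations into primes exist and are unique.

    Exchanging the symbols reverses the order and swaps the two entries of a
    kneading invariant, so every argument is made once, for a symbol b and the
    order [slt b] in which b is the larger symbol.  Admissibility then says that
    the entry b, with its first symbol deleted, is a lower bound for [sle b] of
    all shifts of both entries, strict for those of the other entry.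

    Let theta be the substitution b |-> w_b of a pair W whose periodic sequences
    satisfy these bounds, possibly only weakly, as rotations do.  The key fact is
    a recognizability property with a bounded delay, [shift_substw_gt]: at any
    position of theta(s), either a block w_b has been entered by one symbol, or
    what is read from there is strictly above w_b ~b with its first symbol
    deleted, and the comparison is decided within the length of that word.  Three
    consequences carry the proof.
    - Products with W preserve and reflect admissibility ([star_admissible],
      [star_admissible_inv]).
    - The return times of an entry of a product to itself are block boundaries
      ([block_start_of_period]).
    - If V and W both renormalize an admissible K, then the blocks of the longer
      pair are cut into blocks of the shorter one, so the two are equal or one
      of them is the product of the other with a further pair
      ([renormalizations_comparable]).

    Hence a renormalizable K has a minimal renormalization.  The minimal pair W is
    prime: a renormalization of its periodic invariant by V would make V a
    shorter renormalization of K ([minimal_prime]).  Conversely a prime pair W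
    that renormalizes K is minimal ([prime_minimal]): otherwise W = V * U with V
    minimal, so V would renormalize the periodic invariant of W by that of U.  The
    latter is a kneading invariant because admissibility is reflected, unless W
    generates a rational rotation; but rotations are never products, since their
    two entries agree between the second symbol and the end of the period
    ([rotation_like_not_star]).

    So in any factorization into primes the first factor is the minimal
    renormalization, and uniqueness follows by cancelling factors from the left
    ([starprod_cancel]).  Existence is the iteration of the minimal
    renormalization, whether it stops or not. *)

Definition side (T : Type) (b : bool) (P : T * T) : T := if b then P.1 else P.2.

(** * Lexicographic orders *)

Lemma neq_negb (a b : bool) : a != b -> a = ~~ b.
Proof. by case: a b => [] []. Qed.

(** The lexicographic order for b = 1, its reverse for b = 0. *)
Definition slt (b : bool) (s t : binseq) : Prop :=
  exists n, [/\ forall i, i < n -> s i = t i, s n = ~~ b & t n = b].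

Definition sle (b : bool) (s t : binseq) : Prop := slt b s t \/ s = t.

Lemma slt_flip b s t : slt (~~ b) s t <-> slt b t s.
Proof.
by split=> -[n [E sn tn]]; exists n; split=> [i /E|//|//]; rewrite ?sn ?tn ?negbK.
Qed.

Lemma sle_flip b s t : sle (~~ b) s t <-> sle b t s.
Proof. by split=> -[/slt_flip|->]; [left|right|left|right]. Qed.

Lemma slt_trans b s t r : slt b s t -> slt b t r -> slt b s r.
Proof.
case=> n [En sn tn] [m [Em tm rm]].
case: (ltngtP n m) => [lnm|lmn|enm].
- exists n; split=> // [i lin|]; last by rewrite -Em.
  by rewrite En // Em // (ltn_trans lin).
- exists m; split=> // [i lim|]; last by rewrite En.
  by rewrite En ?Em // (ltn_trans lim).
- by exists n; split=> // [i lin|]; rewrite ?En ?Em -?enm // enm.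
Qed.

Lemma slt_irr b s : ~ slt b s s.
Proof. by case=> n [_ ->]; case: b. Qed.

Lemma sle_trans b s t r : sle b s t -> sle b t r -> sle b s r.
Proof.
by case=> [st|->//] [tr|<-]; left; [apply: slt_trans st tr|].
Qed.

Lemma sle_lt_trans b s t r : sle b s t -> slt b t r -> slt b s r.
Proof. by case=> [st|->] //; apply: slt_trans. Qed.

Lemma sle_not_lt b s t : sle b s t -> ~ slt b t s.
Proof. by move=> st ts; case: (slt_irr (sle_lt_trans st ts)). Qed.

Lemma sle_anti b s t : sle b s t -> sle b t s -> s = t.
Proof. by case=> [st|//] ts; case: (sle_not_lt ts st). Qed.

Lemma slt_total b s t : sle b s t \/ slt b t s.
Proof.
case: (classic (exists n, s n <> t n)) => [|E]; last first.
  left; right; apply: functional_extensionality => n.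
  by apply: NNPP => ne; apply: E; exists n.
case=> m nem.
have ex : exists n, s n != t n by exists m; apply/eqP.
have [n nen minn] := ex_minnP ex.
have E i : i < n -> s i = t i.
  by move=> lin; apply/eqP; apply: contraTT lin => /minn; rewrite -leqNgt.
case: (boolP (t n == b)) => /eqP tn.
  left; left; exists n; split=> //; rewrite -tn in nen *.
  by case: (s n) (t n) nen => [] [].
right; exists n; split=> [i /E//||].
  by case: (t n) b tn => [] [].
by case: (s n) (t n) b nen tn => [] [] [].
Qed.

Lemma slt_not_le b s t : ~ slt b t s -> sle b s t.
Proof. by case: (slt_total b s t). Qed.

Lemma sle_head b s t : sle b s t -> s 0 = b -> t 0 = b.
Proof.
case=> [[n [E sn tn]]|-> //] s0.
by case: n E sn tn => [|n] E sn tn //; rewrite -E.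
Qed.

Lemma slt_head (b : bool) (s t : binseq) : s 0 = ~~ b -> t 0 = b -> slt b s t.
Proof. by exists 0. Qed.

(** * Words in front of sequences *)

Definition scat (u : seq bool) (s : binseq) : binseq :=
  fun i => if i < size u then nth false u i else s (i - size u).

Lemma scat0 s : scat [::] s = s.
Proof. by apply: functional_extensionality => i; rewrite /scat subn0. Qed.

Lemma scat_cons a u s i :
  scat (a :: u) s i = if i is j.+1 then scat u s j else a.
Proof. by case: i. Qed.

Lemma scat_head a u s : scat (a :: u) s 0 = a. Proof. by []. Qed.

Lemma scat_cat u v s : scat (u ++ v) s = scat u (scat v s).
Proof.
elim: u => [|a u IH]; first by rewrite scat0.
by apply: functional_extensionality => -[|i] //; rewrite cat_cons !scat_cons IH.
Qed.

Lemma shift0 s : shift 0 s = s. Proof. by []. Qed.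

Lemma shift_at0 n s : shift n s 0 = s n.
Proof. by rewrite /shift addn0. Qed.

Lemma shift_shift m n s : shift m (shift n s) = shift (m + n) s.
Proof.
by apply: functional_extensionality => i; rewrite /shift addnA (addnC n).
Qed.

Lemma shift_scat u s : shift (size u) (scat u s) = s.
Proof.
apply: functional_extensionality => i.
by rewrite /shift /scat ltnNge leq_addr /= addKn.
Qed.

Lemma shift1_scat a u s : shift 1 (scat (a :: u) s) = scat u s.
Proof. by rewrite -cat1s scat_cat (shift_scat [:: a]). Qed.

Lemma scat_shift n s : s = scat (mkseq s n) (shift n s).
Proof.
apply: functional_extensionality => i; rewrite /scat /shift size_mkseq.
by case: ltnP => [lin|lni]; rewrite ?nth_mkseq // subnKC.
Qed.

Lemma mkseq_scat u s : mkseq (scat u s) (size u) = u.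
Proof.
apply: (@eq_from_nth _ false); rewrite size_mkseq // => i lti.
by rewrite nth_mkseq // /scat lti.
Qed.

Lemma scat_inj u v s t : size u = size v -> scat u s = scat v t -> u = v /\ s = t.
Proof.
move=> eqs eqst; split; last by rewrite -(shift_scat u s) eqs eqst shift_scat.
by rewrite -(mkseq_scat u s) eqs eqst mkseq_scat.
Qed.

Lemma slt_cons b a s t : slt b (scat [:: a] s) (scat [:: a] t) <-> slt b s t.
Proof.
split=> -[n [E sn tn]].
  case: n => [|n] in E sn tn *; first by move: sn tn; rewrite !scat_head => ->; case: (b).
  have rw r i : scat [:: a] r i.+1 = r i by rewrite scat_cons scat0.
  by exists n; rewrite !rw in sn tn; split=> // i lin; have := E i.+1 lin; rewrite !rw.
by exists n.+1; split=> [[|i] lin||]; rewrite ?scat_cons ?scat0 //; apply: E.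
Qed.

Lemma slt_scat b u s t : slt b (scat u s) (scat u t) <-> slt b s t.
Proof.
elim: u => [|a u IH]; first by rewrite !scat0.
by rewrite -cat1s !scat_cat slt_cons IH.
Qed.

Lemma sle_scat b u s t : sle b (scat u s) (scat u t) <-> sle b s t.
Proof.
split=> -[/slt_scat|E]; try by left.
- by right; have [] := scat_inj erefl E.
- by rewrite E; right.
Qed.

(** A comparison decided inside the word p; it holds whatever follows p. *)
Definition wlt (b : bool) (p : seq bool) (s : binseq) : Prop :=
  exists i, [/\ i < size p, forall j, j < i -> s j = nth false p j,
                nth false p i = ~~ b & s i = b].

Lemma wlt_slt b p s t : wlt b p s -> slt b (scat p t) s.
Proof.
case=> i [lti E pi si]; exists i; split=> // [j ltj|]; last by rewrite /scat lti.
by rewrite E // /scat (ltn_trans ltj lti).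
Qed.

Lemma wlt_irr b p t : ~ wlt b p (scat p t).
Proof. by move=> /(wlt_slt t) /slt_irr. Qed.

Lemma wlt_head b p s : head b p = ~~ b -> s 0 = b -> wlt b p s.
Proof.
by case: p => [|a p] /= E s0; [case: b {s0} E | exists 0].
Qed.

Lemma wlt_scat b u p s : wlt b p s -> wlt b (u ++ p) (scat u s).
Proof.
case=> i [lti E pi si]; exists (size u + i); split.
- by rewrite size_cat ltn_add2l.
- move=> j ltj; rewrite nth_cat /scat; case: ltnP => // leuj.
  by rewrite E // ltn_subLR.
- by rewrite nth_cat ltnNge leq_addr addKn.
- by rewrite /scat ltnNge leq_addr addKn.
Qed.

Lemma wlt_catl b p q s : wlt b p s -> wlt b (p ++ q) s.
Proof.
case=> i [lti E pi si]; exists i; split=> //.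
- by rewrite size_cat ltn_addr.
- by move=> j ltj; rewrite nth_cat (ltn_trans ltj lti) E.
- by rewrite nth_cat lti.
Qed.

(** Compare the words letter by letter: either they differ and this decides, or
    one is a prefix of the other and can be cancelled. *)
Lemma sle_words b x u s t : sle b (scat x s) (scat u t) ->
  [\/ forall t', wlt b x (scat u t'),
      exists v, u = x ++ v /\ sle b s (scat v t)
    | exists z, [/\ z <> [::], x = u ++ z & sle b (scat z s) t]].
Proof.
elim: x u => [|a x IH] [|c u] le.
- by constructor 2; exists [::]; rewrite !scat0 in le *.
- by constructor 2; exists (c :: u); rewrite scat0 in le *.
- by constructor 3; exists (a :: x); rewrite [scat [::] t]scat0 in le.
case: (eqVneq a c) => [eac|nac].
  subst c; move: le; rewrite -(cat1s a x) -(cat1s a u) !scat_cat sle_scat.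
  case/IH=> [wl|[v [-> le]]|[z [nz -> le]]].
  - by constructor 1 => t'; rewrite scat_cat; apply: wlt_scat.
  - by constructor 2; exists v.
  - by constructor 3; exists z.
constructor 1 => t'; have := sle_head le; rewrite !scat_head => hd.
case: (eqVneq a b) => [eab|nab]; first by rewrite eab hd // eqxx in nac.
apply: wlt_head => /=; first by case: (a) (b) nab => [] [].
by rewrite scat_head; case: (a) (b) (c) nab nac => [] [] [].
Qed.

(** * Periodic sequences *)

Lemma wordpowE w : wordpow w = scat w (wordpow w).
Proof.
apply: functional_extensionality => i; rewrite /wordpow /scat.
case: ltnP => [lti|lei]; first by rewrite modn_small.
by rewrite -{1}(subnK lei) modnDr.
Qed.

(** The equation s = w s determines s one period after the other. *)
Lemma wordpow_unique w s : 0 < size w -> s = scat w s -> s = wordpow w.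
Proof.
move=> w0 E; apply: functional_extensionality => i.
elim/ltn_ind: i => i IH; rewrite E [RHS](congr1 (fun f => f i) (wordpowE w)).
rewrite /scat; case: ltnP => // lei; apply: IH.
by rewrite ltn_subrL w0 (leq_trans w0).
Qed.

Lemma shift_wordpow r u :
  shift (size r) (wordpow (r ++ u)) = scat u (wordpow (r ++ u)).
Proof. by rewrite {1}wordpowE scat_cat shift_scat. Qed.

Lemma shift1_wordpow c u : shift 1 (wordpow (c :: u)) = scat u (wordpow (c :: u)).
Proof. by rewrite {1}wordpowE shift1_scat. Qed.

(** * Substitutions *)

Definition subw (W : words) (u : seq bool) : seq bool :=
  flatten [seq side c W | c <- u].

Definition nonerasing (W : words) : Prop := forall b, 0 < size (side b W).

Definition block_start (W : words) (s : binseq) (j : nat) : nat :=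
  size (subw W (mkseq s j)).

Lemma subw_cat W u v : subw W (u ++ v) = subw W u ++ subw W v.
Proof. by rewrite /subw map_cat flatten_cat. Qed.

Lemma subw_cons W c u : subw W (c :: u) = side c W ++ subw W u.
Proof. by []. Qed.

Lemma size_subw W u : nonerasing W -> size u <= size (subw W u).
Proof.
move=> W0; elim: u => [|c u IH] //.
by rewrite subw_cons size_cat /= -add1n leq_add.
Qed.

Lemma mkseq_add (s : binseq) j k : mkseq s (j + k) = mkseq s j ++ mkseq (shift j s) k.
Proof.
rewrite /mkseq iotaD map_cat add0n; congr cat.
by rewrite -[X in iota X]addn0 iotaDl -map_comp.
Qed.

Lemma mkseqSr (s : binseq) j : mkseq s j.+1 = rcons (mkseq s j) (s j).
Proof. by rewrite -addn1 mkseq_add cats1 /= /shift addn0. Qed.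

Lemma block_startS W s j :
  block_start W s j.+1 = block_start W s j + size (side (s j) W).
Proof.
by rewrite /block_start mkseqSr -cats1 subw_cat size_cat subw_cons cats0.
Qed.

Lemma block_start_leq W s i j : i <= j -> block_start W s i <= block_start W s j.
Proof.
by move=> /subnKC<-; rewrite /block_start mkseq_add subw_cat size_cat leq_addr.
Qed.

Lemma substw_prefix W s j n : nonerasing W -> n < block_start W s j ->
  substw W s n = nth false (subw W (mkseq s j)) n.
Proof.
move=> W0 ltn.
have E : substw W s n = nth false (subw W (mkseq s n.+1)) n.
  by rewrite /substw /subw /mkseq -map_comp.
rewrite E; case: (leqP j n.+1) => [lej|/ltnW lej].
  by rewrite -(subnKC lej) mkseq_add subw_cat nth_cat ltn.
rewrite -(subnKC lej) [in RHS]mkseq_add subw_cat nth_cat.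
by rewrite (leq_trans _ (size_subw _ W0)) // size_mkseq.
Qed.

(** The substitution is a morphism: the finite images that define the symbols of
    the two sides are prefixes of the same word. *)
Lemma substw_scat W u s : nonerasing W ->
  substw W (scat u s) = scat (subw W u) (substw W s).
Proof.
move=> W0; apply: functional_extensionality => n.
have prefE N : mkseq (scat u s) (size u + N) = u ++ mkseq s N.
  by rewrite mkseq_add mkseq_scat shift_scat.
have bsN N : block_start W (scat u s) (size u + N)
    = size (subw W u) + block_start W s N.
  by rewrite /block_start prefE subw_cat size_cat.
have ltN N : N < block_start W s N.+1.
  by apply: leq_trans (size_subw _ W0); rewrite size_mkseq.
rewrite (@substw_prefix _ _ (size u + n.+1)) //; last first.
  by rewrite bsN ltn_addl // ltN.
rewrite prefE subw_cat nth_cat /scat; case: ltnP => // leun.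
rewrite (@substw_prefix _ _ n.+1) // ?(leq_ltn_trans (leq_subr _ _)) //; exact: ltN.
Qed.

Lemma substw_split W s j : nonerasing W ->
  substw W s = scat (subw W (mkseq s j)) (substw W (shift j s)).
Proof. by move=> W0; rewrite -substw_scat // -scat_shift. Qed.

Lemma shift_block_start W s j : nonerasing W ->
  shift (block_start W s j) (substw W s) = substw W (shift j s).
Proof. by move=> W0; rewrite (substw_split s j W0) shift_scat. Qed.

Lemma substw_first W s : nonerasing W ->
  substw W s = scat (side (s 0) W) (substw W (shift 1 s)).
Proof.
by move=> W0; rewrite (substw_split _ 1 W0) {1}/mkseq /= subw_cons cats0.
Qed.

Lemma substw_wordpow W u : nonerasing W -> 0 < size u ->
  substw W (wordpow u) = wordpow (subw W u).
Proof.
move=> W0 u0; apply: wordpow_unique; last by rewrite {1}wordpowE substw_scat.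
exact: leq_trans (size_subw _ W0).
Qed.

Definition starw (V U : words) : words := (subw V U.1, subw V U.2).

Lemma side_starw V U b : side b (starw V U) = subw V (side b U).
Proof. by case: b. Qed.

Lemma side_star W K b : side b (star W K) = substw W (side b K).
Proof. by case: b. Qed.

Lemma side_wordspow W b : side b (wordspow W) = wordpow (side b W).
Proof. by case: b. Qed.

Lemma side_ext (T : Type) (P Q : T * T) : (forall b, side b P = side b Q) -> P = Q.
Proof.
by case: P Q => [p1 p2] [q1 q2] E; rewrite (E true : p1 = q1) (E false : p2 = q2).
Qed.

Lemma nonerasing_starw V U : nonerasing V -> nonerasing U -> nonerasing (starw V U).
Proof.
by move=> V0 U0 b; rewrite side_starw (leq_trans (U0 b)) // size_subw.
Qed.

Lemma substw_starw V U s : nonerasing V -> nonerasing U ->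
  substw (starw V U) s = substw V (substw U s).
Proof.
move=> V0 U0; apply: functional_extensionality => n.
have VU0 := nonerasing_starw V0 U0.
have E p : subw (starw V U) p = subw V (subw U p).
  by elim: p => // c p IH; rewrite !subw_cons subw_cat IH side_starw.
rewrite (substw_split s n.+1 VU0) (substw_split s n.+1 U0) substw_scat // E.
have lt : n < size (subw V (subw U (mkseq s n.+1))).
  by rewrite -E (leq_trans _ (size_subw _ VU0)) // size_mkseq.
by rewrite /scat lt.
Qed.

Lemma star_starw V U K : nonerasing V -> nonerasing U ->
  star (starw V U) K = star V (star U K).
Proof.
by move=> V0 U0; apply: side_ext => b; rewrite !side_star substw_starw.
Qed.

Definition headed (W : words) : Prop :=
  forall b, side b W = b :: behead (side b W).

Lemma headed_nonerasing W : headed W -> nonerasing W.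
Proof. by move=> hW b; rewrite hW. Qed.

Lemma substw_head W s : headed W -> substw W s 0 = s 0.
Proof.
by move=> hW; rewrite (substw_first _ (headed_nonerasing hW)) hW scat_head.
Qed.

(** The words for the two symbols differ already in their first letters, so the
    images compare as the arguments do. *)
Lemma slt_substw W b s t : headed W -> slt b s t -> slt b (substw W s) (substw W t).
Proof.
move=> hW [n [E sn tn]]; have W0 := headed_nonerasing hW.
rewrite (substw_split s n W0) (substw_split t n W0).
have -> : mkseq s n = mkseq t n.
  by apply/eq_in_map => i; rewrite mem_iota => /E.
by apply/slt_scat/slt_head; rewrite substw_head // /shift addn0.
Qed.

Lemma sle_substw W b s t : headed W -> sle b (substw W s) (substw W t) <-> sle b s t.
Proof.
move=> hW; split=> [le|[/(slt_substw hW)|->]]; try by [left|right].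
by apply: slt_not_le => /(slt_substw hW); apply: sle_not_lt.
Qed.

Lemma slt_substwE W b s t : headed W -> slt b (substw W s) (substw W t) <-> slt b s t.
Proof.
move=> hW; split=> [lt|]; last exact: slt_substw.
case: (slt_total b t s) => // /(sle_substw _ _ _ hW) le.
by case: (sle_not_lt le lt).
Qed.

Lemma substw_inj W s t : headed W -> substw W s = substw W t -> s = t.
Proof.
move=> hW E; apply: (@sle_anti true); apply/(sle_substw _ _ _ hW); rewrite E; by right.
Qed.

Lemma substw_position W s n : nonerasing W ->
  exists j r u, [/\ side (s j) W = r ++ u, u <> [::],
    n = block_start W s j + size r
    & shift n (substw W s) = scat u (substw W (shift j.+1 s))].
Proof.
move=> W0.
have [j [lej ltj]] : exists j, block_start W s j <= n /\ n < block_start W s j.+1.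
  elim: n => [|n [j [lej ltj]]]; first by exists 0; rewrite block_startS addn_gt0 W0 orbT.
  case: (ltnP n.+1 (block_start W s j.+1)) => [lt|le].
    by exists j; rewrite leqW.
  exists j.+1; split=> //; rewrite block_startS.
  apply: leq_trans (_ : block_start W s j.+1 + 1 <= _).
    by rewrite addn1 ltnS.
  by rewrite leq_add2l.
set d := n - block_start W s j.
have ltd : d < size (side (s j) W) by rewrite ltn_subLR // -block_startS.
exists j, (take d (side (s j) W)), (drop d (side (s j) W)); rewrite cat_take_drop.
have sz : size (take d (side (s j) W)) = d by rewrite size_takel // ltnW.
split=> //; first by move/(congr1 size)/eqP; rewrite size_drop subn_eq0 leqNgt ltd.
  by rewrite sz subnKC.
rewrite -{1}(subnK lej) -/d -shift_shift shift_block_start //.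
have hd : shift j s 0 = s j by rewrite /shift addn0.
rewrite substw_first // shift_shift add1n hd.
by rewrite -{1}(cat_take_drop d (side (s j) W)) scat_cat -{1}sz shift_scat.
Qed.

(** * Admissibility of the two sides *)

Definition two_sided (K : kneading) : Prop := forall b, side b K 0 = b.

(** The common part of the two kinds of kneading invariants: all bounds are
    weak, so that rational rotations qualify as well. *)
Definition weakly_admissible (K : kneading) : Prop :=
  two_sided K /\
  forall b c n, sle b (shift 1 (side b K)) (shift n (side c K)).

Lemma lexltE b s t : slt b s t <-> if b then lexlt s t else lexlt t s.
Proof. by case: b => //; apply: (slt_flip true). Qed.

Lemma lexleE b s t : sle b s t <-> if b then lexle s t else lexle t s.
Proof. by case: b => //; rewrite (sle_flip true). Qed.

Lemma admissibleE K : admissible K <->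
  weakly_admissible K /\
  forall b n, slt b (shift 1 (side b K)) (shift n (side (~~ b) K)).
Proof.
split=> [[K1 K2 adm]|[[two wk] st]].
  split; first split.
  - by case.
  - move=> b c n; have [pp pm mp mm] := adm n; apply/lexleE.
    by case: b c => [] [] //=; left.
  - by move=> b n; have [pp pm mp mm] := adm n; apply/lexltE; move: b => [].
split; [exact: (two true) | exact: (two false) | move=> n; split].
- exact: (wk true true).
- exact/(slt_flip true)/(st false).
- exact: (st true).
- exact/(sle_flip true)/(wk false false).
Qed.

(** Otherwise the lower bound, applied to the other entry itself, would force
    that entry to begin with b. *)
Lemma weakly_admissible_second K b : weakly_admissible K -> side b K 1 = ~~ b.
Proof.
case=> two wk; have := sle_head (wk b (~~ b) 0).
rewrite shift0 two /shift addn0; move: (side b K 1) => x.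
by case: x b {wk} => [] [] // /(_ erefl).
Qed.

(** * Recognizability of the blocks *)

(** The properties of an admissible periodic pair that the combinatorial
    arguments use. *)
Record lorenz_words (W : words) : Prop := LorenzWords {
  lorenz_size : forall b, 1 < size (side b W);
  lorenz_head : headed W;
  lorenz_primitive : forall b, primitive_word (side b W);
  lorenz_weak : weakly_admissible (wordspow W)
}.

Lemma lorenz_nonerasing W : lorenz_words W -> nonerasing W.
Proof. by move=> /lorenz_head/headed_nonerasing. Qed.

Lemma lorenz_suffix W b c r u : lorenz_words W -> side c W = r ++ u ->
  sle b (scat (behead (side b W)) (wordpow (side b W))) (scat u (wordpow (side c W))).
Proof.
move=> lW E; have [_ /(_ b c (size r))] := lorenz_weak lW.
rewrite !side_wordspow E (shift_wordpow r u).
by rewrite (lorenz_head lW b) shift1_wordpow.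
Qed.

Lemma lorenz_suffix_head W b c r u s : lorenz_words W -> side c W = r ++ b :: u ->
  s = wordpow (side c W) ->
  sle b (wordpow (side b W)) (scat (b :: u) s).
Proof.
move=> lW E ->; have := lorenz_suffix b lW (etrans E (esym (cat_rcons _ _ _))).
rewrite -(sle_scat b [:: b]) -!scat_cat cat1s -(lorenz_head lW b) cat1s.
by rewrite -wordpowE.
Qed.

Lemma wordpow_head W b : headed W -> wordpow (side b W) 0 = b.
Proof. by move=> hW; rewrite wordpowE hW. Qed.

(** If w_b ended with w_c, where c = ~b, then the bound for c would compare
    w_c followed by powers of w_b with powers of w_c; after cancelling w_c, this
    contradicts the first letters. *)
Lemma lorenz_suffix_code W b r : lorenz_words W -> side b W <> r ++ side (~~ b) W.
Proof.
move=> lW E; have := lorenz_suffix (~~ b) lW (etrans E _).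
move=> /(_ (rcons r (~~ b)) (behead (side (~~ b) W))).
rewrite cat_rcons -(lorenz_head lW) => /(_ erefl) /sle_scat /sle_head.
rewrite !wordpow_head; try exact: lorenz_head.
by move=> /(_ erefl); case: (b).
Qed.

(** If the image begins with b, its first letter decides.  Otherwise it begins
    with w_c, where c = ~b, and admissibility of W gives that z w_b w_b ... is
    not above w_c w_c ... in [sle b].  If z and w_c differ, this decides.  If
    w_c = z v, then v has to begin with b, against the final ~b.  If w_c is a
    proper prefix of z, the rest of z satisfies the same hypotheses, hence the
    induction. *)
Lemma wlt_inner_suffix W b r z s : lorenz_words W ->
  side b W = r ++ z -> head b z = ~~ b -> wlt b (rcons z (~~ b)) (substw W s).
Proof.
move=> lW; have hW := lorenz_head lW; have W0 := lorenz_nonerasing lW.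
have [n] := ubnP (size z); elim: n => // n IH in r z s *; rewrite ltnS => ltz.
move=> Er hz; case: (eqVneq (s 0) b) => [s0|ns0].
  by apply: wlt_head; [case: z hz {ltz Er} => //; case: (b) | rewrite substw_head].
have {ns0} s0 : s 0 = ~~ b by case: (s 0) (b) ns0 => [] [].
rewrite (substw_first _ W0) s0.
have zle : sle b (scat z (wordpow (side b W)))
    (scat (side (~~ b) W) (wordpow (side (~~ b) W))).
  case: z hz Er {ltz} => [|a z] /= ea Er; first by move: ea; case: (b).
  rewrite ea -wordpowE in Er *; apply/sle_flip.
  exact: (@lorenz_suffix_head W (~~ b) b r z _ lW Er).
case/sle_words: zle => [wl|[v [Ev vle]]|[z' [nz' Ez zle]]].
- by rewrite -cats1; apply: wlt_catl.
- rewrite Ev scat_cat -cats1; apply: wlt_scat; apply: wlt_head => //.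
  have := sle_head vle (wordpow_head b hW).
  by case: v {Ev vle} => [|a v] //; rewrite scat0 wordpow_head //; case: (b).
- rewrite Ez rcons_cat; apply: wlt_scat; apply: (IH (r ++ side (~~ b) W)).
  + rewrite (leq_trans _ ltz) // Ez size_cat -[X in X < _]add0n ltn_add2r W0 //.
  + by rewrite Er Ez catA.
  + case: z' nz' zle {Ez} => // a z' _ /sle_head /=.
    rewrite scat_head wordpow_head //.
    by case: (a) (b) => [] [] // /(_ erefl).
Qed.

(** What is read at a position is u followed by an image, where u is a nonempty
    suffix of a block; compare u with the tail x of w_b by the bound for W.  If
    they differ, this decides.  If u = x v with v nonempty, v has to begin
    with b, against the final ~b.  If u = x, the block can only be w_b, which is
    the first alternative.  If x = u z, primitivity of w_b excludes that z begins
    with b, and [wlt_inner_suffix] decides. *)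
Lemma shift_substw_gt W b s n : lorenz_words W ->
  (exists2 j, s j = b & n = (block_start W s j).+1) \/
  wlt b (rcons (behead (side b W)) (~~ b)) (shift n (substw W s)).
Proof.
move=> lW; have hW := lorenz_head lW; have W0 := lorenz_nonerasing lW.
have [j [r [u [Ej nu -> ->]]]] := substw_position s n W0.
have hd c : wordpow (side c W) 0 = c by apply: wordpow_head.
have [wl|[v [Ev vle]]|[z [nz Ez zle]]] := sle_words (lorenz_suffix b lW Ej).
- by right; rewrite -cats1; apply: wlt_catl.
- case: v Ev vle => [|a v] Ev vle.
    have sj : s j = b by have := sle_head vle (hd b); rewrite scat0 hd.
    left; exists j; rewrite // -addn1; congr addn.
    have := congr1 size Ej; rewrite sj Ev cats0 (lorenz_head lW b) size_cat /=.
    by rewrite -addn1 addnC => /eqP; rewrite eqn_add2r => /eqP.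
  right; rewrite Ev scat_cat -cats1; apply: wlt_scat.
  by apply: wlt_head => //; apply: (sle_head vle (hd b)).
right; rewrite Ez rcons_cat; apply: wlt_scat.
have Eb : side b W = (b :: u) ++ z by rewrite (lorenz_head lW b) Ez.
apply: (wlt_inner_suffix _ lW Eb); case: z nz Ez zle Eb => // a z _ Ez zle Eb /=.
case: (eqVneq a b) => [ea|]; last by case: (a) (b) => [] [].
(* If z begins with b, the bounds give z w_b w_b ... = w_b w_b ..., so w_b has
   the same powers as the shorter word z. *)
subst a; have sj : s j = b by have := sle_head zle; rewrite scat_head hd => ->.
rewrite sj in zle; have ge := lorenz_suffix_head lW Eb erefl.
have E := sle_anti zle ge.
have := @lorenz_primitive _ lW b (b :: z) erefl.
rewrite -(wordpow_unique _ (esym E)) // => /(_ erefl).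
by rewrite {1}Eb size_cat /= -[X in _ <= X]add0n leq_add2r.
Qed.

Lemma shift_into_block W s j b : headed W -> s j = b ->
  shift (block_start W s j).+1 (substw W s)
    = scat (behead (side b W)) (substw W (shift j.+1 s)).
Proof.
move=> hW sj; have W0 := headed_nonerasing hW.
rewrite -add1n -shift_shift shift_block_start // substw_first //.
rewrite shift_at0 sj {1}(hW b) -cat1s scat_cat.
by rewrite shift_shift (shift_scat [:: b]).
Qed.

(** * Products of words with kneading invariants *)

(** Inside the blocks the bounds come from recognizability, and one symbol after
    the beginning of a block w_b they reduce to the bounds for K. *)
Lemma star_admissible W K : lorenz_words W -> admissible K -> admissible (star W K).
Proof.
move=> lW /admissibleE [[two wk] st]; apply/admissibleE.
have hW := lorenz_head lW; have W0 := lorenz_nonerasing lW.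
have second b := weakly_admissible_second b (conj two wk).
have first_block b : shift 1 (side b (star W K))
    = scat (behead (side b W)) (substw W (shift 1 (side b K))).
  by rewrite side_star; exact: (shift_into_block (j := 0) hW (two b)).
have second_block b : exists t, shift 1 (side b (star W K))
    = scat (rcons (behead (side b W)) (~~ b)) t.
  rewrite first_block (substw_first _ W0) shift_at0 second (hW (~~ b)).
  by rewrite -[~~ b :: _]cat1s scat_cat -scat_cat cats1; eexists.
have main b c n : sle b (shift 1 (side b (star W K))) (shift n (side c (star W K)))
    /\ (c = ~~ b -> slt b (shift 1 (side b (star W K))) (shift n (side c (star W K)))).
  rewrite [side c _]side_star.
  case: (shift_substw_gt b (side c K) n lW) => [[j sj ->]|].
    rewrite first_block (shift_into_block hW sj).
    rewrite sle_scat sle_substw // slt_scat slt_substwE //; split; first exact: wk.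
    by move->; apply: st.
  have [t ->] := second_block b.
  by move=> /(wlt_slt t) lt; split=> //; left.
split; first split.
- by move=> b; rewrite side_star substw_head.
- by move=> b c n; apply: (main b c n).1.
- by move=> b n; apply: (main b _ n).2.
Qed.

(** All kneading invariants begin with 10 and 01; for several steps this is all
    that matters. *)
Definition opening (K : kneading) : Prop :=
  forall b, side b K 0 = b /\ side b K 1 = ~~ b.

Lemma weakly_admissible_opening K : weakly_admissible K -> opening K.
Proof.
by move=> wk b; split; [case: wk | apply: weakly_admissible_second].
Qed.

Lemma admissible_opening K : admissible K -> opening K.
Proof. by case/admissibleE => /weakly_admissible_opening. Qed.

Lemma star_two_blocks W L b : nonerasing W -> opening L ->
  side b (star W L) =
  scat (side b W) (scat (side (~~ b) W) (substw W (shift 2 (side b L)))).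
Proof.
move=> W0 opL; have [L0 L1] := opL b.
rewrite side_star substw_first // L0 [in LHS]substw_first //.
by rewrite shift_at0 L1 shift_shift.
Qed.

Lemma star_prefix W L b : headed W -> opening L ->
  exists t, side b (star W L) = scat (rcons (side b W) (~~ b)) t.
Proof.
move=> hW opL; rewrite star_two_blocks //; last exact: headed_nonerasing.
exists (scat (behead (side (~~ b) W)) (substw W (shift 2 (side b L)))).
by rewrite -cats1 scat_cat; congr scat; rewrite -scat_cat cat1s -hW.
Qed.

Lemma block_start2 W s : block_start W s 2 = size (side (s 0) W) + size (side (s 1) W).
Proof. by rewrite !block_startS. Qed.

(** An occurrence of w_b ~b is not strictly above itself, so recognizability
    leaves only the boundary of a block. *)
Lemma block_start_of_prefix W b s m t : lorenz_words W ->
  shift m (substw W s) = scat (rcons (side b W) (~~ b)) t ->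
  exists2 j, s j = b & m = block_start W s j.
Proof.
move=> lW E; case: (shift_substw_gt b s m.+1 lW) => [[j sj [->]]|]; first by exists j.
rewrite -add1n -shift_shift E (lorenz_head lW b) rcons_cons.
by rewrite shift1_scat => /wlt_irr.
Qed.

Lemma block_start_of_period W b L m : lorenz_words W -> opening L -> 0 < m ->
  shift m (side b (star W L)) = side b (star W L) ->
  exists2 j, 1 < j /\ side b L j = b & m = block_start W (side b L) j.
Proof.
move=> lW opL m0 E; have W0 := lorenz_nonerasing lW.
have [t Et] := star_prefix b (lorenz_head lW) opL.
rewrite {2}Et side_star in E.
have [j Lj Ej] := block_start_of_prefix lW E.
exists j => //; split=> //; have [_ L1] := opL b.
case: j Lj Ej => [|[|j]] //; first by move=> _ e; rewrite e in m0.
by rewrite L1; case: (b).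
Qed.

(** If s were strictly below ~b s, it would begin with a run of ~b up to the first
    difference, and there ~b s would repeat the last symbol of that run instead
    of having b. *)
Lemma sle_cons b s : sle b (scat [:: ~~ b] s) s.
Proof.
apply: slt_not_le => -[[|k] [E sk]]; rewrite scat_cons; first by case: (b).
rewrite scat0; suff -> : s k = ~~ b by case: (b).
have: k < k.+1 by [].
elim: {-2}k => [|i IH] lt; rewrite E // scat_cons // scat0 IH // ltnW //.
Qed.

Lemma shift_cons n s : shift n s = scat [:: s n] (shift n.+1 s).
Proof.
by rewrite [LHS](scat_shift 1) shift_shift /= /mkseq /= shift_at0.
Qed.

(** After a symbol b, the bounds for M are those for the product, with the tail
    of w_b cancelled.  After a symbol ~b they follow from the bounds one
    position earlier by [sle_cons]. *)
Lemma star_admissible_inv W M : lorenz_words W -> opening M ->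
  admissible (star W M) -> admissible M.
Proof.
move=> lW opM /admissibleE [[_ wk] st]; have hW := lorenz_head lW.
have first_block b : shift 1 (side b (star W M))
    = scat (behead (side b W)) (substw W (shift 1 (side b M))).
  by rewrite side_star; exact: (shift_into_block (j := 0) hW (opM b).1).
have after b c n : side c M n = b -> sle b (shift 1 (side b M)) (shift n.+1 (side c M))
    /\ (c = ~~ b -> slt b (shift 1 (side b M)) (shift n.+1 (side c M))).
  move=> Mn; have := wk b c (block_start W (side c M) n).+1.
  have := st b (block_start W (side c M) n).+1.
  rewrite first_block side_star [side c (star _ _)]side_star.
  rewrite (shift_into_block hW Mn) sle_scat sle_substw // => lt le; split=> // ec.
  by move: lt; rewrite -ec (shift_into_block hW Mn) slt_scat slt_substwE.
have main b c n : sle b (shift 1 (side b M)) (shift n (side c M))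
    /\ (c = ~~ b -> slt b (shift 1 (side b M)) (shift n (side c M))).
  elim: n => [|n [IHle IHlt]].
    case: (eqVneq c b) => [->|nc].
      split; last by case: (b).
      by left; apply: slt_head; rewrite shift_at0; case: (opM b).
    have {nc} -> : c = ~~ b by case: (c) (b) nc => [] [].
    suff lt : slt b (shift 1 (side b M)) (shift 0 (side (~~ b) M)) by split=> //; left.
    rewrite (shift_cons 1) (shift_cons 0) (opM b).2 (opM (~~ b)).1 slt_scat.
    apply/slt_flip; apply: (after (~~ b) b 1 (opM b).2).2.
    by rewrite negbK.
  case: (eqVneq (side c M n) b) => [/after//|nb].
  have {}nb : side c M n = ~~ b by case: (side c M n) (b) nb => [] [].
  have step : sle b (shift n (side c M)) (shift n.+1 (side c M)).
    by rewrite shift_cons nb; apply: sle_cons.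
  split; first exact: sle_trans IHle step.
  move=> /IHlt lt; case: step => [|<-] //; exact: slt_trans lt.
apply/admissibleE; split; first split.
- by move=> b; case: (opM b).
- by move=> b c n; apply: (main b c n).1.
- by move=> b n; apply: (main b _ n).2.
Qed.

Lemma scat_prefix u v s t : scat u s = scat v t -> size u <= size v ->
  exists z, v = u ++ z /\ s = scat z t.
Proof.
move=> E le; rewrite -(cat_take_drop (size u) v) scat_cat in E.
have [E1 E2] := scat_inj (esym (size_takel le)) E.
by exists (drop (size u) v); split=> //; rewrite {1}E1 cat_take_drop.
Qed.

Definition opening_words (U : words) : Prop :=
  forall b, exists u, side b U = [:: b, ~~ b & u].

(** * Two renormalizations of the same invariant *)

(** If v_b is longer than w_b then it begins with w_b ~b, so it can occur only at
    the boundaries of W. *)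
Lemma finer_block_start W V A B b c j : lorenz_words W -> lorenz_words V ->
  opening A -> opening B -> star W A = star V B ->
  size (side b W) < size (side b V) -> side c B j = b ->
  exists2 i, side c A i = b & block_start V (side c B) j = block_start W (side c A) i.
Proof.
move=> lW lV opA opB E lt Bj.
have W0 := lorenz_nonerasing lW; have V0 := lorenz_nonerasing lV.
have [t Et] := star_prefix b (lorenz_head lW) opA.
have [z [Ez _]] : exists z, side b V = rcons (side b W) (~~ b) ++ z /\
    t = scat z (scat (side (~~ b) V) (substw V (shift 2 (side b B)))).
  by apply: scat_prefix; rewrite ?size_rcons // -Et E star_two_blocks.
have Ec : substw W (side c A) = substw V (side c B) by rewrite -!side_star E.
apply: (@block_start_of_prefix W b _ _ (scat z (substw V (shift j.+1 (side c B)))) lW).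
rewrite Ec shift_block_start // substw_first // shift_at0 Bj Ez.
by rewrite scat_cat shift_shift.
Qed.

Lemma cat_suffix (x u y v : seq bool) : x ++ u = y ++ v -> size v <= size u ->
  exists r, u = r ++ v /\ y = x ++ r.
Proof.
move=> E le; have lexy : size x <= size y.
  have := congr1 size E; rewrite !size_cat => eqs.
  by rewrite -(leq_add2r (size u)) eqs leq_add2l.
have Ey : y = x ++ drop (size x) y.
  have := congr1 (take (size x)) E; rewrite take_size_cat // takel_cat // => {1}->.
  by rewrite cat_take_drop.
exists (drop (size x) y); split=> //.
have := congr1 (drop (size x)) E.
by rewrite drop_size_cat // {1}Ey -catA drop_size_cat.
Qed.

Lemma subw_rcons_inv W u y b : lorenz_words W -> subw W u = y ++ side b W ->
  exists u', subw W u' = y /\ u = rcons u' b.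
Proof.
move=> lW; case: (lastP u) => [|u' c] E.
  have := congr1 size E; rewrite size_cat => /esym/eqP.
  by rewrite addn_eq0 (gtn_eqF (lorenz_nonerasing lW b)) andbF.
move: E; rewrite -cats1 subw_cat subw_cons cats0 => E.
exists u'; rewrite cats1; case: (eqVneq c b) => [ec|nc].
  subst c; have [r [Er ->]] := cat_suffix E (leqnn _).
  have := congr1 size Er; rewrite size_cat => /eqP.
  by rewrite -[X in X == _]add0n eqn_add2r => /eqP/esym/size0nil ->; rewrite cats0.
exfalso; have {nc} ec : c = ~~ b by case: (c) (b) nc => [] [].
subst c; case: (leqP (size (side b W)) (size (side (~~ b) W))) => [|/ltnW] le.
  have [r [Er _]] := cat_suffix E le.
  by apply: (@lorenz_suffix_code W (~~ b) r lW); rewrite negbK.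
have [r [Er _]] := cat_suffix (esym E) le.
exact: (@lorenz_suffix_code W b r lW).
Qed.

Lemma subw_cons_inv W u y b : headed W -> subw W u = side b W ++ y ->
  exists u', subw W u' = y /\ u = b :: u'.
Proof.
move=> hW; case: u => [|c u]; first by rewrite (hW b).
rewrite subw_cons => E; have Ec := congr1 (head b) E.
rewrite (hW c) (hW b) /= in Ec; subst c.
by exists u; split=> //; have := congr1 (drop (size (side b W))) E; rewrite !drop_size_cat.
Qed.

(** By the suffix code property, trailing blocks can be recognized from the
    right. *)
Lemma subw_nseq_inv W V u x b k : lorenz_words W -> side b W = side b V ->
  subw W u = x ++ subw V (nseq k b) -> exists u', subw W u' = x.
Proof.
move=> lW Eb; elim: k u => [|k IH] u; first by rewrite cats0; exists u.
rewrite -addn1 nseqD subw_cat catA subw_cons cats0 -Eb.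
by case/(subw_rcons_inv lW) => u' [/IH].
Qed.

Lemma switch_index (b : bool) (s : binseq) i j : s i = ~~ b -> i <= j -> s j = b ->
  exists k, s k = ~~ b /\ s k.+1 = b.
Proof.
move=> si /subnKC <-; elim: (j - i) => [|d IH]; rewrite ?addn0 ?addnS.
  by rewrite si; case: (b).
case: (eqVneq (s (i + d)) b) => [/IH//|nd sd]; exists (i + d); split=> //.
exact: neq_negb.
Qed.

(** Let c = ~b, so that v_c = w_c.  The powers of an image v_b of b c ... contain
    w_c followed by the letter b, whereas the bound of V for c compares them
    with the powers of w_c, where w_c is followed by c. *)
Lemma no_one_sided_product W V u b : lorenz_words W -> lorenz_words V ->
  side (~~ b) W = side (~~ b) V -> side b V <> subw W [:: b, ~~ b & u].
Proof.
move=> lW lV Ew Ev; have hW := lorenz_head lW; have W0 := lorenz_nonerasing lW.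
set s := wordpow [:: b, ~~ b & u].
have Es : wordpow (side b V) = substw W s by rewrite Ev -substw_wordpow.
have [k [sk sk1]] : exists k, s k = ~~ b /\ s k.+1 = b.
  apply: (@switch_index b s 1 (size u).+2) => //.
  by rewrite /s /wordpow modnn.
have [_ /(_ (~~ b) b (block_start W s k).+1)] := lorenz_weak lV.
rewrite !side_wordspow -Ew Es (shift_into_block hW sk) {1}hW.
rewrite shift1_wordpow -hW sle_scat => /sle_head.
by rewrite wordpow_head // substw_head // shift_at0 sk1 => /(_ erefl); case: (b).
Qed.

(** Let c = ~b.  The entry c of V * B begins with v_c v_b v_c ... v_c v_b, and the
    last of these blocks is at a boundary of W.  If v_c = w_c, stripping the
    copies of v_c before it from the right shows that v_b is a product of words
    of W, which [no_one_sided_product] excludes. *)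
Lemma refine_not_one_sided W V A B b : lorenz_words W -> lorenz_words V ->
  opening A -> admissible B -> star W A = star V B ->
  size (side b W) < size (side b V) -> side (~~ b) W <> side (~~ b) V.
Proof.
move=> lW lV opA admB E lt Ew; have opB := admissible_opening admB.
have hW := lorenz_head lW; have hV := lorenz_head lV.
have W0 := lorenz_nonerasing lW; have V0 := lorenz_nonerasing lV.
(* An infinite run of ~b would be the least of all sequences, while B has a
   strict lower bound. *)
have ex : exists j, side (~~ b) B j.+2 == b.
  apply: NNPP => no; have /admissibleE [_ st] := admB.
  have tail j : side (~~ b) B j.+2 = ~~ b.
    case: (eqVneq (side (~~ b) B j.+2) b) => [e|].
      by case: no; exists j; apply/eqP.
    exact: neq_negb.
  have [n [_ _]] := st b 2.
  by rewrite /shift add2n tail; case: (b).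
have [k /eqP Bk mink] := ex_minnP ex.
have [i Ai Ei] := finer_block_start lW lV opA opB E lt Bk.
have prefB : mkseq (side (~~ b) B) k.+2 = [:: ~~ b, b & nseq k (~~ b)].
  apply: (@eq_from_nth _ false); first by rewrite size_mkseq /= size_nseq.
  move=> [|[|l]]; rewrite size_mkseq // => ltl; rewrite nth_mkseq //=.
  - by case: (opB (~~ b)).
  - by rewrite (opB (~~ b)).2 negbK.
  rewrite nth_nseq -(ltn_add2l 2) ltl.
  case: (eqVneq (side (~~ b) B l.+2) b) => [/eqP/mink|].
    by rewrite leqNgt -(ltn_add2l 2) ltl.
  exact: neq_negb.
have [u] : exists u, subw W u = side (~~ b) W ++ side b V.
  apply: (@subw_nseq_inv W V (mkseq (side (~~ b) A) i) _ (~~ b) k lW Ew).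
  rewrite [in RHS]Ew -catA -!subw_cons -prefB.
  have [] // := @scat_inj (subw W (mkseq (side (~~ b) A) i))
    (subw V (mkseq (side (~~ b) B) k.+2)) (substw W (shift i (side (~~ b) A)))
    (substw V (shift k.+2 (side (~~ b) B))).
  by rewrite -!substw_split // -!side_star E.
case/(subw_cons_inv hW) => {}u [Eu _].
have [t Et] := star_prefix b hW opA.
have [z [Ez _]] : exists z, side b V = rcons (side b W) (~~ b) ++ z /\
    t = scat z (scat (side (~~ b) V) (substw V (shift 2 (side b B)))).
  by apply: scat_prefix; rewrite ?size_rcons // -Et E star_two_blocks.
have := Eu; rewrite [in RHS]Ez cat_rcons => /(subw_cons_inv hW) [[|c u'] [// + Eu']].
rewrite subw_cons hW => -[Ec _]; apply: (@no_one_sided_product W V u' b lW lV Ew).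
by rewrite -Eu Eu' Ec.
Qed.

(** The second block of the entry ~b of V * B is v_b, so it starts at a boundary
    of W, which is not before the end of the first block of the entry ~b of
    W * A. *)
Lemma refine_not_crossed W V A B b : lorenz_words W -> lorenz_words V ->
  opening A -> opening B -> star W A = star V B ->
  size (side b W) < size (side b V) ->
  size (side (~~ b) W) <= size (side (~~ b) V).
Proof.
move=> lW lV opA opB E lt; rewrite leqNgt; apply/negP => lt'.
have [|i Ai] := finer_block_start (j := 1) lW lV opA opB E lt (c := ~~ b).
  by rewrite (opB _).2 negbK.
have -> : block_start V (side (~~ b) B) 1 = size (side (~~ b) V).
  by rewrite block_startS (opB _).1.
case: i Ai => [|i] Ai Ei.
  by have := lorenz_nonerasing lV (~~ b); rewrite Ei.
move: lt'; rewrite Ei ltnNge => /negP; apply.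
apply: leq_trans (block_start_leq _ _ (ltn0Sn i)).
by rewrite block_startS (opA _).1.
Qed.

(** Both words of V are longer, so the second block of each entry of V * B starts
    at a boundary of W, and the first block is a product of words of W. *)
Lemma refine_gt W V A B b : lorenz_words W -> lorenz_words V ->
  admissible A -> admissible B -> star W A = star V B ->
  size (side b W) < size (side b V) ->
  exists2 U, opening_words U & V = starw W U.
Proof.
move=> lW lV admA admB E lt.
have [opA opB] := (admissible_opening admA, admissible_opening admB).
have hW := lorenz_head lW; have W0 := lorenz_nonerasing lW.
have V0 := lorenz_nonerasing lV.
have firstV c : side c (star V B) = scat (side c V) (substw V (shift 1 (side c B))).
  by rewrite side_star substw_first // (opB c).1.
have lts c : size (side c W) < size (side c V).
  case: (eqVneq c b) => [->//|/neq_negb ->].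
  rewrite ltn_neqAle (refine_not_crossed lW lV opA opB E lt) andbT.
  apply/eqP => es; apply: (refine_not_one_sided lW lV opA admB E lt).
  have e := firstV (~~ b); rewrite -E star_two_blocks // in e.
  by have [] := scat_inj es e.
have block c : exists u, side c V = subw W [:: c, ~~ c & u].
  have [|i Ai Ei] := finer_block_start (j := 1) lW lV opA opB E (lts (~~ c)) (c := c).
    by rewrite (opB _).2.
  have e := firstV c; rewrite -E side_star (substw_split _ i W0) in e.
  have [|eV _] := scat_inj _ e.
    by rewrite -/(block_start W (side c A) i) -Ei block_startS (opB _).1.
  case: i Ai Ei e eV => [|[|i]] Ai Ei _ eV.
  - by have := V0 c; rewrite -eV.
  - by have := lts c; rewrite -eV subw_cons cats0 (opA c).1 ltnn.
  exists (mkseq (shift 2 (side c A)) i); rewrite -eV -(add2n i) mkseq_add.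
  by rewrite {1}/mkseq /= (opA c).1 (opA c).2.
have [[ut Et] [uf Ef]] := (block true, block false).
exists ([:: true, false & ut], [:: false, true & uf]).
  by case; [exists ut | exists uf].
by apply: side_ext => c; rewrite side_starw; case: c.
Qed.

Lemma renormalizations_comparable W V A B : lorenz_words W -> lorenz_words V ->
  admissible A -> admissible B -> star W A = star V B ->
  [\/ W = V, exists2 U, opening_words U & V = starw W U
    | exists2 U, opening_words U & W = starw V U].
Proof.
move=> lW lV admA admB E.
case: (classic (exists b, size (side b W) <> size (side b V))) => [[b ne]|eq].
  case: (ltngtP (size (side b W)) (size (side b V))) => [lt|lt|//].
    by constructor 2; apply: refine_gt E lt.
  by constructor 3; apply: refine_gt (esym E) lt.
constructor 1; apply: side_ext => b.
have [opA opB] := (admissible_opening admA, admissible_opening admB).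
have := congr1 (side b) E; rewrite !star_two_blocks //; try exact: lorenz_nonerasing.
by case/scat_inj => //; apply: NNPP => ne; apply: eq; exists b.
Qed.

(** * Rational rotations *)

(** The two one-sided orbits of the cut point of a rotation of order q are at the
    two ends of the interval after one step, that is at the same point of the
    circle, and then have equal codes until they return to the cut point. *)
Definition rotation_like (q : nat) (K : kneading) : Prop :=
  [/\ 0 < q, weakly_admissible K, forall b, shift q (side b K) = side b K,
      forall b c i, 1 < i < q -> side b K i = side c K i
    & exists n, shift n (side true K) = side false K].

(** In a product, the entries would begin with v_1 v_0 and v_0 v_1, words of a
    length at most q that agree from their third letters on.  If v_0 and v_1
    have equal length this fails where the second blocks begin; otherwise the
    shorter one is a suffix of the longer one, against the suffix code
    property. *)
Lemma rotation_like_not_star q V L K : lorenz_words V -> rotation_like q K ->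
  opening L -> K <> star V L.
Proof.
move=> lV [q0 _ per agree _] opL EK.
have hV := lorenz_head lV; have V0 := lorenz_nonerasing lV.
have leq b : size (side b V) + size (side (~~ b) V) <= q.
  have := per b; rewrite EK => /(block_start_of_period lV opL q0) [j [j2 _] ->].
  apply: leq_trans (block_start_leq _ _ j2).
  by rewrite block_start2 (opL b).1 (opL b).2.
have first b i : i < size (side b V) -> side b K i = nth false (side b V) i.
  by move=> lt; rewrite EK star_two_blocks // /scat lt.
have second b i : i < size (side (~~ b) V) ->
    side b K (size (side b V) + i) = nth false (side (~~ b) V) i.
  move=> lt; rewrite EK star_two_blocks // {1}/scat ltnNge leq_addr /= addKn.
  by rewrite /scat lt.
have lt_contra b : size (side b V) < size (side (~~ b) V) -> False.
  move=> lt; apply: (@lorenz_suffix_code V (~~ b)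
    (take (size (side (~~ b) V) - size (side b V)) (side (~~ b) V)) lV).
  rewrite negbK -[LHS](cat_take_drop (size (side (~~ b) V) - size (side b V))).
  congr cat; apply: (@eq_from_nth _ false).
    by rewrite size_drop subKn // ltnW.
  rewrite size_drop (subKn (ltnW lt)) => i lti.
  have lti' : size (side (~~ b) V) - size (side b V) + i < size (side (~~ b) V).
    by rewrite -ltn_subRL subKn // ltnW.
  rewrite nth_drop -second // addnA (subnKC (ltnW lt)).
  rewrite (agree b (~~ b)); last first.
    rewrite (leq_trans (lorenz_size lV (~~ b))) ?leq_addr //=.
    by apply: leq_trans (leq b); rewrite addnC ltn_add2r.
  by have := second (~~ b) i; rewrite negbK => ->.
case: (ltngtP (size (side true V)) (size (side false V))) => [lt|lt|es].
- exact: (lt_contra true).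
- exact: (lt_contra false).
have K1 : side true K (size (side true V)) = false.
  by rewrite -[size _]addn0 second // hV.
have K0 : side false K (size (side true V)) = true.
  by rewrite es -[size _]addn0 second // hV.
have ltq : size (side true V) < q.
  by apply: leq_trans (leq true); rewrite -[X in X < _]addn0 ltn_add2l.
have := agree true false (size (side true V)).
by rewrite lorenz_size // ltq K1 K0 => /(_ erefl).
Qed.

(** The itinerary under the rotation by p/q of the circle cut into q arcs,
    starting in the arc m; the arcs from q - p on are coded 1. *)
Definition rotation_code (p q m : nat) : binseq := fun n => q - p <= (n * p + m) %% q.

Lemma shift_rotation_code p q m n :
  shift n (rotation_code p q m) = rotation_code p q (n * p + m).
Proof.
by apply: functional_extensionality => i; rewrite /shift /rotation_code mulnDl -addnA addnCA.
Qed.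

Lemma rotation_code_mod p q m m' : m = m' %[mod q] ->
  rotation_code p q m = rotation_code p q m'.
Proof.
move=> E; apply: functional_extensionality => i.
by rewrite /rotation_code -modnDmr E modnDmr.
Qed.

(** The rotation preserves the order of two arcs as long as they lie on the same
    side of the cut. *)
Lemma rotation_code_le p q m m' : p < q -> m <= m' -> m' < q ->
  sle true (rotation_code p q m) (rotation_code p q m').
Proof.
move=> ltpq lemm ltm; apply: slt_not_le => -[n [E En' En]].
suff le i : i <= n -> (i * p + m) %% q <= (i * p + m') %% q.
  by move: En En'; rewrite /rotation_code => h; rewrite (leq_trans h (le n _)).
elim: i => [|i IH] lin; first by rewrite !add0n !modn_small // (leq_ltn_trans lemm).
have {IH} := IH (ltnW lin); have := E i lin; rewrite /rotation_code.
rewrite !mulSn -!addnA -(modnDmr p (i * p + m)) -(modnDmr p (i * p + m')).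
have q0 : 0 < q by apply: leq_ltn_trans ltpq.
have := ltn_pmod (i * p + m) q0; have := ltn_pmod (i * p + m') q0.
move: (_ %% q) ((i * p + m) %% q) => x' x ltx' ltx side lex.
case: (leqP (q - p) x) side => [ge|lt] side.
  have wrap y : y < q -> q - p <= y -> (p + y) %% q = p + y - q.
    move=> lty gey; have le : q <= p + y by rewrite -leq_subLR.
    rewrite -{1}(subnK le) modnDr modn_small // ltn_subLR //.
    by rewrite -addnS leq_add // ltnW.
  by rewrite !wrap // leq_sub2r // leq_add2l.
rewrite !modn_small ?leq_add2l // -ltn_subRL //.
by rewrite ltnNge side.
Qed.

(** The arcs on the two sides of c are q - p and q - p - 1; their successors are
    the first and the last arc, which gives the bounds.  Two adjacent arcs have
    different codes only at c and at the end points, that is at the times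
    congruent to 0 or 1 modulo q. *)
Lemma rotation_code_pair p q K : 0 < p < q -> coprime p q ->
  K.1 = rotation_code p q (q - p) -> K.2 = rotation_code p q (q - p).-1 ->
  rotation_like q K.
Proof.
case/andP=> p0 ltpq cop E1 E2; have q0 := ltn_trans p0 ltpq.
have qp0 : 0 < q - p by rewrite subn_gt0.
have sh1 : shift 1 K.1 = rotation_code p q 0.
  rewrite E1 shift_rotation_code mul1n subnKC ?(ltnW ltpq) //.
  by apply: rotation_code_mod; rewrite modnn mod0n.
have sh2 : shift 1 K.2 = rotation_code p q q.-1.
  by rewrite E2 shift_rotation_code mul1n -subn1 addnBA // subnKC ?subn1 // ltnW.
have code b n : exists2 m, m < q & shift n (side b K) = rotation_code p q m.
  exists ((n * p + (if b then q - p else (q - p).-1)) %% q); first by rewrite ltn_mod.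
  rewrite /side; case: b; rewrite ?E1 ?E2 shift_rotation_code;
    by apply: rotation_code_mod; rewrite modn_mod.
have top n : (q - p <= (n + (q - p)) %% q) = (q - p <= (n + (q - p).-1) %% q) \/
    q %| n \/ q %| n + (q - p).
  have := ltn_pmod (n + (q - p).-1) q0; move Ex : ((n + (q - p).-1) %% q) => x.
  have Exp : n + (q - p) = x.+1 %[mod q].
    by rewrite -addn1 -Ex modnDml addn1 -addnS prednK.
  rewrite leq_eqVlt => /orP[/eqP xq|ltx].
    by right; right; rewrite /dvdn Exp xq modnn.
  rewrite Exp modn_small //; case: (eqVneq x.+1 (q - p)) => [e|ne].
    right; left; have : n + (q - p) == 0 + (q - p) %[mod q] by rewrite Exp e add0n.
    by rewrite eqn_modDr mod0n.
  by left; rewrite [LHS]leq_eqVlt eq_sym (negbTE ne) ltnS.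
split=> //.
- have ltqp : q - p < q by rewrite ltn_subrL p0.
  split.
    case; rewrite /= ?E1 ?E2 /rotation_code mul0n add0n modn_small //.
    - by rewrite leqnn.
    - by rewrite leqNgt ltn_predL qp0.
    - exact: leq_ltn_trans (leq_pred _) ltqp.
  move=> b c n; have [m ltm ->] := code c n.
  case: b => /=; first by rewrite sh1; apply: rotation_code_le.
  rewrite sh2; apply/(sle_flip true); apply: rotation_code_le => //.
    by rewrite -ltnS prednK.
  by rewrite ltn_predL.
- by case=> /=; rewrite ?E1 ?E2 shift_rotation_code; apply: rotation_code_mod;
    rewrite (mulnC q) modnMDl.
- suff agree i : 1 < i < q -> K.1 i = K.2 i.
    by move=> [] [] i /agree /=.
  case/andP=> i1 iq; rewrite E1 E2 /rotation_code.
  case: (top (i * p)) => // -[]; first by rewrite Gauss_dvdl ?(coprime_sym q) // gtnNdvd // ltnW.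
  case: i i1 iq => // i i1 iq.
  rewrite mulSn -addnA addnC -addnA subnK ?(ltnW ltpq) // dvdn_addl //.
  by rewrite Gauss_dvdl ?(coprime_sym q) // gtnNdvd // ltnW.
(* km inverts p modulo q; the orbit moves from arc q - p to arc q - p - 1 after
   km (q - 1) steps. *)
have [km kn E _] := egcdnP q p0; exists (km * q.-1) => /=.
rewrite E1 E2 shift_rotation_code; apply: rotation_code_mod.
rewrite mulnAC E (eqP cop) mulnDl mul1n mulnAC -addnA modnMDl.
have -> : q.-1 + (q - p) = q + (q - p).-1 by rewrite -{1}(prednK qp0) addnS -addSn prednK.
by rewrite modnDl.
Qed.

Section Rotations.
Local Open Scope R_scope.

Lemma frac_part_eq (r : R) (k : Z) (x : R) : r = IZR k + x -> 0 <= x < 1 -> frac_part r = x.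
Proof.
move=> E x01; rewrite /frac_part -(@Int_part_spec r k); lra.
Qed.

Lemma INR_add m n : INR (m + n)%N = INR m + INR n. Proof. exact: plus_INR. Qed.

Lemma INR_mul m n : INR (m * n)%N = INR m * INR n. Proof. exact: mult_INR. Qed.

Lemma INR_sub m n : (n <= m)%N -> INR (m - n)%N = INR m - INR n.
Proof. by move/leP; apply: minus_INR. Qed.

Lemma INR_div_lt j q e : (j < q)%N -> 0 < e < / INR q -> 0 < INR j / INR q + e < 1.
Proof.
move=> /ltP ltj e0; have j0 := pos_INR j.
have : INR j.+1 <= INR q by apply: le_INR.
rewrite S_INR => le; have q0 : 0 < INR q by lra.
have iq0 := Rinv_0_lt_compat _ q0; have iqE : INR q * / INR q = 1 by field; lra.
rewrite /Rdiv; nra.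
Qed.

(** A point keeps its distance e from the left end of its arc.  For
    m = q - p and small e it is just to the right of c, for m = q - p - 1 and e
    near 1/q just to the left of c. *)
Lemma rotation_iter p q m n e : (p < q)%N -> (m < q)%N -> 0 < e < / INR q ->
  iter n (rotation (INR p / INR q)) (INR m / INR q + e)
    = INR ((n * p + m) %% q) / INR q + e.
Proof.
move=> ltp ltm e0; elim: n => [|n IH]; first by rewrite mul0n add0n modn_small.
rewrite iterS IH /rotation mulSn -addnA -(modnDmr p (n * p + m)).
have q0 : (0 < q)%N by apply: leq_ltn_trans ltp.
have qR : INR q <> 0 by apply: not_0_INR => q_0; rewrite q_0 in q0.
have := ltn_pmod (n * p + m) q0; move: ((n * p + m) %% q)%N => x ltx.
case: (ltnP (p + x) q) => [lt|le].
  rewrite modn_small //; apply: (@frac_part_eq _ 0).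
    by rewrite INR_add; field.
  by have := INR_div_lt lt e0; lra.
have lt : (p + x - q < q)%N by rewrite ltn_subLR // -addnS leq_add // ltnW.
rewrite -{1}(subnK le) modnDr modn_small //; apply: (@frac_part_eq _ 1).
  by rewrite INR_sub // INR_add; field.
by have := INR_div_lt lt e0; lra.
Qed.

Lemma coded_rotation p q j e b : (p < q)%N -> 0 < e < / INR q ->
  coded (1 - INR p / INR q) (INR j / INR q + e) b -> b = (q - p <= j)%N.
Proof.
move=> ltp e0; have le : (p <= q)%N by apply: ltnW.
have q0 : 0 < INR q by apply: lt_0_INR; apply/ltP; apply: leq_ltn_trans ltp.
have iq0 := Rinv_0_lt_compat _ q0; have iqE : INR q * / INR q = 1 by field; lra.
have -> : 1 - INR p / INR q = INR (q - p) / INR q by rewrite INR_sub //; field; lra.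
rewrite /coded /Rdiv; case: b; case: leqP => // /leP h c.
  have : INR j.+1 <= INR (q - p) by apply: le_INR.
  by rewrite S_INR => h'; nra.
have : INR (q - p) <= INR j by apply: le_INR.
by move=> h'; nra.
Qed.

Lemma rational_rotation_like K : rational_rotation K -> exists q, rotation_like q K.
Proof.
case=> p' [q' /= [/andP[p'0 ltp'] rightK leftK]].
have q'0 := ltn_trans p'0 ltp'.
have g0 : (0 < gcdn p' q')%N by rewrite gcdn_gt0 p'0.
set p := (p' %/ gcdn p' q')%N; set q := (q' %/ gcdn p' q')%N.
have Ep : p' = (p * gcdn p' q')%N by rewrite divnK // dvdn_gcdl.
have Eq : q' = (q * gcdn p' q')%N by rewrite divnK // dvdn_gcdr.
have pq : (0 < p < q)%N.
  by apply/andP; split; [rewrite divn_gt0 // dvdn_leq // dvdn_gcdl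
                        | rewrite -(ltn_pmul2r g0) -Ep -Eq].
have cop : coprime p q.
  by rewrite /coprime -(eqn_pmul2r g0) mul1n muln_gcdl -Ep -Eq.
have [p0 ltpq] := andP pq; have q0 := ltn_trans p0 ltpq.
have toR n : (0 < n)%N -> 0 < INR n by move=> /ltP; apply: lt_0_INR.
have Ea : INR p' / INR q' = INR p / INR q.
  have [g q_] := (toR _ g0, toR _ q0).
  rewrite (congr1 INR Ep) (congr1 INR Eq) !INR_mul; field; lra.
rewrite Ea in rightK leftK; exists q.
have q_ := toR _ q0; have iq0 := Rinv_0_lt_compat _ q_.
have le : (p <= q)%N by apply: ltnW.
apply: (rotation_code_pair pq cop); apply: functional_extensionality => n.
- have [d d0 /(_ (1 - INR p / INR q + Rmin d (/ INR q) / 2))] := rightK n.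
  have : 0 < Rmin d (/ INR q) by apply: Rmin_glb_lt.
  have := Rmin_l d (/ INR q); have := Rmin_r d (/ INR q).
  move: (Rmin _ _) => e e1 e2 e3 /(_ _) h.
  have {h} := h ltac:(lra).
  have -> : 1 - INR p / INR q = INR (q - p) / INR q by rewrite INR_sub //; field; lra.
  rewrite rotation_iter //; last lra; last by rewrite ltn_subrL p0.
  have -> : INR (q - p) / INR q = 1 - INR p / INR q by rewrite INR_sub //; field; lra.
  by apply: coded_rotation => //; lra.
have [d d0 /(_ (1 - INR p / INR q - Rmin d (/ INR q) / 2))] := leftK n.
have : 0 < Rmin d (/ INR q) by apply: Rmin_glb_lt.
have := Rmin_l d (/ INR q); have := Rmin_r d (/ INR q).
move: (Rmin _ _) => e e1 e2 e3 /(_ _) h.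
have {h} := h ltac:(lra).
have qp0 : (0 < q - p)%N by rewrite subn_gt0.
have Ec : 1 - INR p / INR q - e / 2 = INR (q - p).-1 / INR q + (/ INR q - e / 2).
  have := S_INR (q - p).-1; rewrite prednK // INR_sub // => E.
  have -> : INR (q - p).-1 = INR q - INR p - 1 by lra.
  by field; lra.
rewrite Ec rotation_iter //; last lra.
  by apply: coded_rotation => //; lra.
by rewrite (leq_ltn_trans (leq_pred _)) // ltn_subrL p0.
Qed.

End Rotations.

(** * Minimal renormalizations *)

Lemma kneading_weakly_admissible K : kneading_invariant K -> weakly_admissible K.
Proof.
by case=> [/admissibleE[]//|/rational_rotation_like [q []]].
Qed.

Lemma periodic_lorenz W : periodic_admissible W -> lorenz_words W.
Proof.
case=> -[s1 s2] [h1 h2] [p1 p2] /kneading_weakly_admissible wk; split=> //.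
- by case.
- case=> /=; first by case: W.1 s1 h1 => //= a w _ ->.
  by case: W.2 s2 h2 => //= a w _ ->.
- by case.
Qed.

Lemma size_starw V U b : nonerasing V -> opening_words U ->
  size (side b V) < size (side b (starw V U)).
Proof.
move=> V0 opU; rewrite side_starw; have [u ->] := opU b.
by rewrite !subw_cons size_cat -addn1 leq_add2l size_cat ltn_addr.
Qed.

Lemma renormalizes_comparable K W V A B : admissible K ->
  renormalizes W K A -> renormalizes V K B ->
  [\/ W = V, exists2 U, opening_words U & V = starw W U
    | exists2 U, opening_words U & W = starw V U].
Proof.
move=> admK [/periodic_lorenz lW _ /(_ admK) admA EA] [/periodic_lorenz lV _ /(_ admK) admB EB].
by apply: (renormalizations_comparable lW lV admA admB); rewrite -EA.
Qed.

(** Take a renormalization with the shortest word for the symbol 1; the words of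
    any other one are at least as long because the two are comparable. *)
Lemma minimal_renormalization K : admissible K -> renormalizable K ->
  exists W L, minimally_renormalizes W K L.
Proof.
move=> admK [W [L]]; have [n] := ubnP (size W.1).
elim: n => // n IH in W L *; rewrite ltnS => ltW rW.
have [lW _ _ _] := rW; move/periodic_lorenz/lorenz_nonerasing: lW => W0.
case: (classic (exists V M, renormalizes V K M /\ size V.1 < size W.1)).
  by move=> [V [M [rV lt]]]; apply: (IH V M _ rV); apply: leq_trans lt ltW.
move=> no; exists W, L; split=> // V M rV.
case: (renormalizes_comparable admK rW rV) => [->//|[U opU ->]|[U opU EW]].
  by split; apply: ltnW; [apply: (size_starw true)|apply: (size_starw false)].
case: no; exists V, M; split=> //; rewrite EW; apply: (size_starw true) => //.
by apply: lorenz_nonerasing; apply: periodic_lorenz; case: rV.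
Qed.

Lemma minimal_not_coarser K W L V U : minimally_renormalizes W K L ->
  opening_words U -> (exists M, renormalizes V K M) -> W <> starw V U.
Proof.
move=> [_ minW] opU [M rV] EW; have [le _] := minW _ _ rV.
have [/periodic_lorenz/lorenz_nonerasing V0 _ _ _] := rV.
by have := size_starw true V0 opU; rewrite ltnNge -EW le.
Qed.

Lemma minimal_unique K W V A B : admissible K ->
  minimally_renormalizes W K A -> minimally_renormalizes V K B -> W = V /\ A = B.
Proof.
move=> admK mW mV; have [rW _] := mW; have [rV _] := mV.
have EWV : W = V.
  case: (renormalizes_comparable admK rW rV) => [//|[U opU E]|[U opU E]].
    by case: (minimal_not_coarser mV opU _ E); exists A.
  by case: (minimal_not_coarser mW opU _ E); exists B.
split=> //; subst V; case: rW rV => pW _ _ EA [_ _ _ EB].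
apply: side_ext => b; apply: (@substw_inj W).
  by apply: lorenz_head; apply: periodic_lorenz.
by rewrite -!side_star -EA -EB.
Qed.

Lemma wordspow_starw V U : nonerasing V -> nonerasing U ->
  wordspow (starw V U) = star V (wordspow U).
Proof.
move=> V0 U0; apply: side_ext => b.
by rewrite side_star !side_wordspow side_starw substw_wordpow.
Qed.

Lemma opening_nonerasing U : opening_words U -> nonerasing U.
Proof. by move=> opU b; have [u ->] := opU b. Qed.

Lemma opening_star U A : opening_words U -> two_sided A -> opening (star U A).
Proof.
move=> opU tA b; have [u E] := opU b.
by rewrite side_star substw_first ?tA ?E //; apply: opening_nonerasing.
Qed.

Lemma opening_wordspow U : opening_words U -> opening (wordspow U).
Proof.
by move=> opU b; rewrite side_wordspow wordpowE; have [u ->] := opU b.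
Qed.

(** If V renormalizes the periodic invariant of W, its words are products of
    words of V because the periods are return times.  So W = V * U, and V
    renormalizes K with U * A as the quotient; this contradicts minimality. *)
Lemma minimal_prime K W A : admissible K -> minimally_renormalizes W K A ->
  prime_words W.
Proof.
move=> admK mW; have [[pW _ admA EK] _] := mW; have [_ _ _ kW] := pW.
split=> //; split=> // -[V [L [pV kL _ EW]]].
have lW := periodic_lorenz pW; have lV := periodic_lorenz pV.
have [W0 V0] := (lorenz_nonerasing lW, lorenz_nonerasing lV).
have opL := weakly_admissible_opening (kneading_weakly_admissible kL).
have block b : exists2 u, exists v, u = [:: b, ~~ b & v] & side b W = subw V u.
  have E : shift (size (side b W)) (side b (star V L)) = side b (star V L).
    by rewrite -EW side_wordspow {1}wordpowE shift_scat.
  have [j [j2 _] Ej] := block_start_of_period lV opL (W0 b) E.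
  exists (mkseq (side b L) j).
    case: j j2 {Ej} => [|[|j]] // _; exists (mkseq (shift 2 (side b L)) j).
    by rewrite -(add2n j) mkseq_add {1}/mkseq /= (opL b).1 (opL b).2.
  have := congr1 (side b) EW; rewrite side_star side_wordspow (substw_split _ j V0).
  by rewrite wordpowE => /scat_inj [].
have [[ut opt Et] [uf opf Ef]] := (block true, block false).
have opU : opening_words (ut, uf) by case.
have EU : W = starw V (ut, uf) by apply: side_ext => b; rewrite side_starw; case: b.
apply: (minimal_not_coarser mW opU _ EU); exists (star (ut, uf) A).
have EK' : K = star V (star (ut, uf) A).
  by rewrite EK {1}EU star_starw //; apply: opening_nonerasing.
have adm : admissible (star (ut, uf) A).
  apply: (star_admissible_inv lV); last by rewrite -EK'.
  by apply: opening_star => // b; case: (admissible_opening (admA admK) b).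
by split=> //; left.
Qed.

(** The minimal renormalization V of K is either W itself or satisfies W = V * U.
    In the second case the periodic invariant of W is the product of V with
    that of U, which has to be shown to be a kneading invariant. *)
Lemma prime_minimal K W A : admissible K -> prime_words W -> admissible A ->
  K = star W A -> minimally_renormalizes W K A.
Proof.
move=> admK [pW [kW nrW]] admA EK; have rW : renormalizes W K A by split=> //; left.
have [V [B mV]] : exists V B, minimally_renormalizes V K B.
  by apply: minimal_renormalization => //; exists W, A.
have [rV _] := mV; have lW := periodic_lorenz pW.
case: (renormalizes_comparable admK rW rV) => [EV|[U opU EV]|[U opU EW]].
- suff -> : A = B by rewrite EV.
  apply: side_ext => b; apply: (substw_inj (lorenz_head lW)).
  rewrite -!side_star -EK; case: rV => _ _ _ ->; by rewrite EV.
- by case: (minimal_not_coarser mV opU _ EV); exists A.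
case: nrW; exists V, (wordspow U); have [pV _ _ _] := rV.
have lV := periodic_lorenz pV.
have Epow : wordspow W = star V (wordspow U).
  by rewrite EW wordspow_starw //; [apply: lorenz_nonerasing | apply: opening_nonerasing].
have admU : admissible (wordspow W) -> admissible (wordspow U).
  by rewrite Epow; apply: star_admissible_inv => //; apply: opening_wordspow.
split=> //; case: kW => [/admU|/rational_rotation_like [q rot]]; first by left.
by case: (rotation_like_not_star lV rot (opening_wordspow opU) Epow).
Qed.

(** * Factorizations *)

Lemma Riter_admissible K n L : admissible K -> Riter n K L -> admissible L.
Proof.
move=> admK; elim: n L => [|n IH] L /=; first by move=> <-.
by case=> K1 [/IH adm1 [W [[_ _ /(_ adm1)]]]].
Qed.

Lemma Riter_unique K n L M : admissible K -> Riter n K L -> Riter n K M -> L = M.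
Proof.
move=> admK; elim: n L M => [|n IH] L M /=; first by move=> <-.
move=> [K1 [r1 [W mW]]] [K2 [r2 [V mV]]].
have E := IH _ _ r1 r2; subst K2.
by case: (minimal_unique (Riter_admissible admK r1) mW mV).
Qed.

Lemma starprod_rcons Ws W L : starprod (rcons Ws W) L = starprod Ws (star W L).
Proof. by rewrite /starprod foldr_rcons. Qed.

Lemma Riter_factors K n L : admissible K -> Riter n K L ->
  exists Ws, [/\ size Ws = n, forall W, W \in Ws -> prime_words W & K = starprod Ws L].
Proof.
move=> admK; elim: n L => [|n IH] L /=; first by move=> ->; exists [::].
case=> K1 [r1 [W mW]]; have [Ws [sz pr EK]] := IH _ r1.
exists (rcons Ws W); split; first by rewrite size_rcons sz.
  move=> V; rewrite mem_rcons in_cons => /orP[/eqP ->|/pr //].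
  exact: minimal_prime (Riter_admissible admK r1) mW.
by rewrite starprod_rcons EK; case: mW => -[_ _ _ ->].
Qed.

Lemma starprod_admissible Ws L : (forall W, W \in Ws -> prime_words W) ->
  admissible L -> admissible (starprod Ws L).
Proof.
elim: Ws => // W Ws IH pr admL; apply: star_admissible.
  by apply: periodic_lorenz; case: (pr W (mem_head _ _)).
by apply: IH => // V memV; apply: pr; rewrite in_cons memV orbT.
Qed.

(** If the last factor were a rotation, one entry of the product would be a shift
    of the other, against the strict bounds. *)
Lemma starprod_admissible_inv Ws L : (forall W, W \in Ws -> prime_words W) ->
  kneading_invariant L -> admissible (starprod Ws L) -> admissible L.
Proof.
move=> pr [//|/rational_rotation_like [q [_ _ _ _ orbit]]].
suff [n En] : exists n, shift n (side true (starprod Ws L)) = side false (starprod Ws L).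
  case/admissibleE => _ /(_ false n.+1) lt; case: (@slt_irr false (shift 1 (side false (starprod Ws L)))).
  by rewrite -[in X in slt _ _ X]En shift_shift.
elim: Ws pr => // W Ws IH pr.
have [|n En] := IH; first by move=> V memV; apply: pr; rewrite in_cons memV orbT.
exists (block_start W (side true (starprod Ws L)) n).
have W0 : nonerasing W.
  by apply: lorenz_nonerasing; apply: periodic_lorenz; case: (pr W (mem_head _ _)).
rewrite -[starprod (W :: Ws) L]/(star W (starprod Ws L)).
by rewrite (side_star _ _ true) (side_star _ _ false) shift_block_start // En.
Qed.

(** The first factor of either product is its minimal renormalization, so the
    factors cancel one by one. *)
Lemma starprod_cancel Ws Ws' L L' :
  (forall W, W \in Ws -> prime_words W) -> (forall W, W \in Ws' -> prime_words W) ->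
  admissible L -> admissible L' -> starprod Ws L = starprod Ws' L' ->
  size Ws <= size Ws' -> exists T, Ws' = Ws ++ T /\ L = starprod T L'.
Proof.
elim: Ws Ws' => [|W Ws IH] Ws'; first by move=> *; exists Ws'.
case: Ws' => // W' Ws' pr pr' admL admL' E; rewrite ltnS => le.
have tail V : V \in Ws -> prime_words V by move=> m; apply: pr; rewrite in_cons m orbT.
have tail' V : V \in Ws' -> prime_words V by move=> m; apply: pr'; rewrite in_cons m orbT.
have adm := starprod_admissible pr admL.
have mW := prime_minimal adm (pr W (mem_head _ _)) (starprod_admissible tail admL) erefl.
have mW' := prime_minimal adm (pr' W' (mem_head _ _)) (starprod_admissible tail' admL') E.
have [<- {}E] := minimal_unique adm mW mW'.
have [T [-> EL]] := IH _ tail tail' admL admL' E le.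
by exists T.
Qed.

Lemma prime_not_starprod L T L' : prime_kneading L ->
  (forall W, W \in T -> prime_words W) -> admissible L' -> L = starprod T L' -> T = [::].
Proof.
case: T => // W T [_ nr] pr admL' E; case: nr; exists W, (starprod T L').
have adm : admissible (starprod T L').
  by apply: starprod_admissible => // V m; apply: pr; rewrite in_cons m orbT.
by split=> //; [case: (pr W (mem_head _ _)) | left].
Qed.

Lemma mem_mkseq_prime (W : nat -> words) n : (forall i, prime_words (W i)) ->
  forall V, V \in mkseq W n -> prime_words V.
Proof. by move=> pr V /mapP [i _ ->]. Qed.

Lemma finite_infinite_exclusive K Ws L W : admissible K ->
  prime_factorization K (FiniteFact Ws L) -> ~ prime_factorization K (InfiniteFact W).
Proof.
move=> admK [pr prL EK] [prW inf].
have [M /(Riter_admissible admK) admM EM] := inf (size Ws).+1 isT.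
have prm := mem_mkseq_prime (n := (size Ws).+1) prW.
have admL : admissible L.
  by case: prL => kL _; apply: (starprod_admissible_inv pr kL); rewrite -EK.
have [||T [ET EL]] := starprod_cancel pr prm admL admM; first by rewrite -EK.
  by rewrite size_mkseq.
have T0 : T = [::].
  apply: (prime_not_starprod prL _ admM EL) => V m; apply: prm.
  by rewrite ET mem_cat m orbT.
by have := congr1 size ET; rewrite T0 cats0 size_mkseq => /eqP; rewrite eqn_leq ltnn.
Qed.

(** Compare the factorizations as far as the shorter one goes; what is left over
    is a factorization of a prime invariant. *)
Lemma prime_factorization_unique K F F' : admissible K ->
  prime_factorization K F -> prime_factorization K F' -> F = F'.
Proof.
move=> admK; case: F F' => [Ws L|W] [Ws' L'|W'].
- wlog le : Ws L Ws' L' / size Ws <= size Ws'.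
    move=> H h h'; case: (leqP (size Ws) (size Ws')) => [le|/ltnW le]; first exact: H.
    by apply/esym/H.
  move=> [pr prL EK] [pr' prL' EK'].
  have admL : admissible L.
    by case: prL => kL _; apply: (starprod_admissible_inv pr kL); rewrite -EK.
  have admL' : admissible L'.
    by case: prL' => kL' _; apply: (starprod_admissible_inv pr' kL'); rewrite -EK'.
  have [|T [ET EL]] := starprod_cancel pr pr' admL admL' _ le; first by rewrite -EK.
  have T0 : T = [::].
    apply: (prime_not_starprod prL _ admL' EL) => V m; apply: pr'.
    by rewrite ET mem_cat m orbT.
  by rewrite ET EL T0 cats0.
- by move=> f i; case: (finite_infinite_exclusive admK f i).
- by move=> i f; case: (finite_infinite_exclusive admK f i).
move=> [pr inf] [pr' inf']; congr InfiniteFact; apply: functional_extensionality => i.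
have [M /(Riter_admissible admK) admM EM] := inf i.+1 isT.
have [M' /(Riter_admissible admK) admM' EM'] := inf' i.+1 isT.
have [||T [ET _]] := starprod_cancel (mem_mkseq_prime (n := i.+1) pr)
    (mem_mkseq_prime (n := i.+1) pr') admM admM'; first by rewrite -EM.
  by rewrite !size_mkseq.
have := congr1 (fun s => nth ([::], [::]) s i) ET.
by rewrite nth_cat size_mkseq ltnSn !nth_mkseq.
Qed.

Lemma infinite_factorization K : admissible K -> infinitely_renormalizable K ->
  exists W : nat -> words, (forall i, prime_words (W i)) /\ infinite_starprod K W.
Proof.
move=> admK inf.
have exK n : exists L, Riter n K L.
  elim: n => [|n [L rL]]; first by exists K.
  have [W [M mW]] := minimal_renormalization (Riter_admissible admK rL) (inf _ _ rL).
  by exists M, L; split=> //; exists W.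
have Kn n : {L | Riter n K L} by apply: constructive_indefinite_description.
have Wn n : {W | minimally_renormalizes W (sval (Kn n)) (sval (Kn n.+1))}.
  apply: constructive_indefinite_description.
  have [K1 [r1 ex]] := svalP (Kn n.+1).
  by rewrite (Riter_unique admK (svalP (Kn n)) r1).
exists (fun n => sval (Wn n)); split=> [i|n _].
  exact: minimal_prime (Riter_admissible admK (svalP (Kn i))) (svalP (Wn i)).
exists (sval (Kn n)); first exact: svalP.
elim: n => [|n IH]; first by have := svalP (Kn 0).
rewrite /mkseq -(addn1 n) iotaD map_cat cats1 add0n starprod_rcons -/(mkseq _ _).
have [[_ _ _ E] _] := svalP (Wn n).
by rewrite {1}IH addn1 -E.
Qed.

Theorem theorem1 (K : kneading) (HK : admissible K) :
  (exists! F : factorization, prime_factorization K F) /\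
  (finitely_renormalizable K ->
     exists (m : nat) (L : kneading) (W : m.-tuple words),
       [/\ 0 < m, Riter m K L, prime_kneading L,
           forall i : 'I_m, prime_words (tnth W i)
         & K = starprod W L]) /\
  (infinitely_renormalizable K ->
     exists W : nat -> words,
       (forall i, prime_words (W i)) /\ infinite_starprod K W).
Proof.
have stop m L : Riter m K L -> ~ renormalizable L -> prime_kneading L.
  by move=> /(Riter_admissible HK) admL nr; split=> //; left.
split; last split.
- suff [F fF] : exists F, prime_factorization K F.
    by exists F; split=> // F'; apply: prime_factorization_unique.
  case: (classic (exists m L, Riter m K L /\ ~ renormalizable L)).
    case=> m [L [r nr]]; have [Ws [_ pr EK]] := Riter_factors HK r.
    by exists (FiniteFact Ws L); split=> //; apply: stop r nr.
  move=> no; have [|W fW] := infinite_factorization HK; last by exists (InfiniteFact W).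
  by move=> m L r; apply: NNPP => nr; apply: no; exists m, L.
- case=> ren [m [L [r nr]]]; have [Ws [sz pr EK]] := Riter_factors HK r.
  subst m; exists (size Ws), L, (in_tuple Ws); split=> //.
  + by case: Ws r {pr EK} => //= EKL; case: nr; rewrite -EKL.
  + exact: stop r nr.
  + by move=> i; apply: pr; apply: mem_tnth.
- exact: infinite_factorization.
Qed.
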